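(* Let $H:\mathcal{L}_{2e}^n\to\mathcal{L}_{2e}^n$ be a causal system, let $M=M^\top\in\mathbb{R}^{m\times m}$, and let $N$ be the causal, bounded LTI system with transfer function $N(s)=C_N(sI-A_N)^{-1}B_N+D_N$, where $A_N\in\mathbb{R}^{k\times k}$ is Hurwitz, $B_N\in\mathbb{R}^{k\times 2n}$, $C_N\in\mathbb{R}^{m\times k}$, $D_N\in\mathbb{R}^{m\times 2n}$. Suppose $H$ satisfies the hard incremental IQC with multipliers $(M,N)$. If there exist a symmetric matrix $\Pi\in\mathbb{R}^{2\times2}$, a matrix $P=P^\top\succeq 0$ and a number $\tau>0$ such that $$\begin{bmatrix} A_N^\top P+PA_N & PB_N\\ B_N^\top P & -\Pi\otimes I_n\end{bmatrix}+\tau V^\top M V\preceq 0,\qquad V=[C_N,\ D_N],$$ then $\mathrm{SRG}_e(H)$ is contained in $\mathcal{S}(\Pi)=\{z\in\mathbb{C}\mid [1;\ z]^*\,\Pi\,[1;\ z]\ge 0\}$.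
   Context: $\mathcal{L}_2^n$ is the space of square-integrable signals $u:[0,\infty)\to\mathbb{R}^n$ with norm $\|u\|=(\int_0^\infty u^\top u\,dt)^{1/2}$ and inner product $\langle u,y\rangle=\int_0^\infty u^\top y\,dt$; $\mathcal{L}_{2e}^n$ is the set of signals whose truncations $u_T$ ($u_T(t)=u(t)$ for $t\le T$, $0$ for $t>T$) lie in $\mathcal{L}_2^n$ for every $T\ge0$. A system is an operator $H:\mathcal{L}_{2e}^n\to\mathcal{L}_{2e}^n$ with $H0=0$; it is causal if $(Hu)_T=(Hu_T)_T$ for all $T\ge 0$ and $u$. The extended graph is $G_e(H)=\{(u,y)\in\mathcal{L}_{2e}^n\times\mathcal{L}_{2e}^n\mid y=Hu\}$. For $u,y\in\mathcal{L}_2^n$, the gain $\rho(u,y)$ is $\|y\|/\|u\|$ if $u\neq0$, $0$ if $u=y=0$, $\infty$ if $u=0\ne y$; the phase $\theta(u,y)=\arccos\frac{\langle u,y\rangle}{\|u\|\|y\|}$ if $u,y\ne0$, and $0$ otherwise; for $T>0$ set $\rho_T(u,y)=\rho(u_T,y_T)$, $\theta_T(u,y)=\theta(u_T,y_T)$. The hard scaled relative graph is $\mathrm{SRG}_e(H)=\{\rho_T(\Delta u,\Delta y)e^{\pm j\theta_T(\Delta u,\Delta y)}\mid (u_1,y_1),(u_2,y_2)\in G_e(H),\ (\Delta u)_T\ne0,\ T>0\}$ with $\Delta u=u_1-u_2$, $\Delta y=y_1-y_2$. $N$ acts on signals via its state-space realization $\dot x_N=A_Nx_N+B_N v$, $g=C_Nx_N+D_N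 v$ with $x_N(0)=0$. $H$ satisfies the hard incremental IQC with multipliers $(M,N)$ if $\int_0^T (N[\Delta u;\Delta y])^\top(t)\,M\,(N[\Delta u;\Delta y])(t)\,dt\ge 0$ for all $(u_1,y_1),(u_2,y_2)\in G_e(H)$ and all $T>0$. *)

(* Defs.v *)
From HB Require Import structures.
From mathcomp Require Import all_boot all_order all_algebra.
From mathcomp Require Import all_classical all_reals all_analysis.
From mathcomp Require Import complex.
Set Implicit Arguments. Unset Strict Implicit. Unset Printing Implicit Defensive.
Import Order.TTheory GRing.Theory Num.Theory.
Import numFieldNormedType.Exports.
Local Open Scope classical_set_scope.
Local Open Scope ring_scope.

Section IQC.
Variable R : realType.
Local Notation mu := (@lebesgue_measure R).

(* signals on the time axis; only t >= 0 is ever used (via truncation) *)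
Definition sig (n : nat) := R -> 'cV[R]_n.

(* truncation u_T (also zero for t < 0, the time axis being [0, oo)) *)
Definition trunc n (T : R) (u : sig n) : sig n :=
  fun t => if (0 <= t) && (t <= T) then u t else 0.

Definition dotv n (a b : 'cV[R]_n) : R := \sum_i a i 0 * b i 0.

Definition inL2 n (u : sig n) : Prop :=
  (forall i, measurable_fun (`[0%R, +oo[ : set R) (fun t => u t i 0)) /\
  (\int[mu]_(t in (`[0%R, +oo[ : set R)) (dotv (u t) (u t))%:E < +oo)%E.

Definition inL2e n (u : sig n) : Prop := forall T, 0 <= T -> inL2 (trunc T u).

Definition ip n (u y : sig n) : R :=
  fine (\int[mu]_(t in (`[0%R, +oo[ : set R)) (dotv (u t) (y t))%:E).
Definition nrm n (u : sig n) : R := Num.sqrt (ip u u).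

(* gain (only used when u <> 0, the case relevant to the SRG) *)
Definition gain n (u y : sig n) : R := if nrm u != 0 then nrm y / nrm u else 0.
Definition phase n (u y : sig n) : R :=
  if (nrm u != 0) && (nrm y != 0) then acos (ip u y / (nrm u * nrm y)) else 0.

Definition ssub n (u1 u2 : sig n) : sig n := fun t => u1 t - u2 t.

Definition is_system n (H : sig n -> sig n) : Prop :=
  (forall u, inL2e u -> inL2e (H u)) /\ H (fun _ => 0) = (fun _ => 0).

Definition causal n (H : sig n -> sig n) : Prop :=
  forall T u, 0 <= T -> inL2e u -> trunc T (H u) = trunc T (H (trunc T u)).

Definition SRGe n (H : sig n -> sig n) : set R[i] :=
  [set z | exists u1 u2 T (s : bool),
      [/\ inL2e u1, inL2e u2, 0 < T,
          nrm (trunc T (ssub u1 u2)) != 0 &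
          let du := trunc T (ssub u1 u2) in
          let dy := trunc T (ssub (H u1) (H u2)) in
          z = Complex (gain du dy * cos (phase du dy))
              ((-1) ^+ s * (gain du dy * sin (phase du dy)))]].

Definition SPi (Pi : 'M[R]_2) : set R[i] :=
  [set z | let w : 'cV[R[i]]_2 := \col_i (if i == ord0 then 1 else z) in
           0 <= ((map_mx Num.conj w)^T *m map_mx (fun a => Complex a 0) Pi *m w) 0 0].

(* state-space solution x of  x' = A x + B v,  x(0) = 0  (integral form) *)
Definition state_sol k p (A : 'M[R]_k) (B : 'M[R]_(k, p)) (v : sig p) (x : sig k)
  : Prop :=
  forall t, 0 <= t -> forall i,
    mu.-integrable (`[0%R, t] : set R) (fun s => ((A *m x s + B *m v s) i 0)%:E) /\
    x t i 0 = fine (\int[mu]_(s in (`[0%R, t] : set R)) ((A *m x s + B *m v s) i 0)%:E).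

Definition hard_iqc n m k (H : sig n -> sig n) (M : 'M[R]_m)
  (AN : 'M[R]_k) (BN : 'M[R]_(k, n + n)) (CN : 'M[R]_(m, k)) (DN : 'M[R]_(m, n + n))
  : Prop :=
  forall u1 u2, inL2e u1 -> inL2e u2 ->
  let v : sig (n + n) := fun t => col_mx (u1 t - u2 t) (H u1 t - H u2 t) in
  forall x, state_sol AN BN v x ->
  forall T, 0 < T ->
  (0 <= \int[mu]_(t in (`[0%R, T] : set R))
          (let g := CN *m x t + DN *m v t in (g^T *m M *m g) 0 0)%:E)%E.

Definition hurwitz k (A : 'M[R]_k) : Prop :=
  forall l : R[i], eigenvalue (map_mx (fun a => Complex a 0) A) l -> complex.Re l < 0.

Definition psd k (Q : 'M[R]_k) : Prop := forall x : 'cV[R]_k, 0 <= (x^T *m Q *m x) 0 0.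
Definition nsd k (Q : 'M[R]_k) : Prop := forall x : 'cV[R]_k, (x^T *m Q *m x) 0 0 <= 0.

Definition kronI n (Pi : 'M[R]_2) : 'M[R]_(n + n) :=
  block_mx (Pi ord0 ord0)%:M (Pi ord0 ord_max)%:M (Pi ord_max ord0)%:M (Pi ord_max ord_max)%:M.

Definition lmi n m k (M : 'M[R]_m) (AN : 'M[R]_k) (BN : 'M[R]_(k, n + n))
  (CN : 'M[R]_(m, k)) (DN : 'M[R]_(m, n + n)) (Pi : 'M[R]_2) (P : 'M[R]_k) (tau : R)
  : Prop :=
  let V : 'M[R]_(m, k + (n + n)) := row_mx CN DN in
  nsd (block_mx (AN^T *m P + P *m AN) (P *m BN) (BN^T *m P) (- kronI n Pi)
       + tau *: (V^T *m M *m V)).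

End IQC.

(* Main.v *)
Require Import Defs.
From HB Require Import structures.
From mathcomp Require Import all_boot all_order all_algebra.
From mathcomp Require Import all_classical all_reals all_analysis.
From mathcomp Require Import measurable_realfun complex.
From mathcomp Require Import ring lra.
Set Implicit Arguments. Unset Strict Implicit. Unset Printing Implicit Defensive.
Import Order.TTheory GRing.Theory Num.Theory.
Import numFieldNormedType.Exports.
Local Open Scope classical_set_scope.
Local Open Scope ring_scope.

(** For two input-output pairs put [v = (du, dy)] and let [x] be the state of [N]
driven by [v].  Along this trajectory the LMI reads
[d/dt (x^T P x) + tau g^T M g <= v^T (Pi (x) I) v]; integrating over [[0, T]] and
using [x(0) = 0], [P >= 0] and the hard IQC gives
[0 <= Pi11 |du|^2 + (Pi12 + Pi21) <du, dy> + Pi22 |dy|^2], which after division by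
[|du|^2] is membership of the corresponding point of the SRG in [S(Pi)].  The state
[x] is obtained by Picard iteration, and as it is only an integral of a locally
integrable function, [x^T P x] is differentiated by means of Fubini's theorem. *)

(** * Primitives of integrable functions and their product rule *)

Section Primitives.
Variable R : realType.
Local Notation mu := (@lebesgue_measure R).
Local Notation prim f t := (\int[mu]_(s in `[0%R, t]) f s).
Implicit Types (f g : R -> R) (T : R).

Lemma itv_lty (T : R) : (mu `[0%R, T] < +oo)%E.
Proof. by rewrite /= lebesgue_measure_itv/=; case: ifP => _; rewrite ?ltry. Qed.

Lemma integrable_itv_le f T t : t <= T ->
  mu.-integrable `[0, T] (EFin \o f) -> mu.-integrable `[0, t] (EFin \o f).
Proof.
move=> tT; apply: integrableS => //; apply: subset_itvl.
by rewrite bnd_simp.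
Qed.

Lemma measurable_prim f T : 0 <= T -> mu.-integrable `[0, T] (EFin \o f) ->
  measurable_fun (`[0, T] : set R) (fun t => prim f t).
Proof.
move=> T0 fi; apply: subspace_continuous_measurable_fun => //.
exact: parameterized_integral_continuous.
Qed.

Lemma prim_le_norm f T t : t <= T -> mu.-integrable `[0, T] (EFin \o f) ->
  `|prim f t| <= \int[mu]_(s in `[0, T]) `|f s|.
Proof.
move=> tT fi; have fti := integrable_itv_le tT fi.
apply: le_trans (le_normr_Rintegral _ fti) _ => //.
have h1 := integrable_norm fi; have h2 := integrable_norm fti.
rewrite -lee_fin !fineK; try exact: integrable_fin_num.
apply: ge0_subset_integral => //.
- exact: measurable_int h1.
- by apply: subset_itvl; rewrite bnd_simp.
Qed.

Lemma bounded_prim f T : mu.-integrable `[0, T] (EFin \o f) ->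
  [bounded prim f t | t in (`[0, T] : set R)].
Proof.
move=> fi; rewrite /bounded_near; near=> M => t /=.
rewrite in_itv/= => /andP[t0 tT].
apply: le_trans (prim_le_norm tT fi) _.
by near: M; apply: nbhs_pinfty_ge; rewrite num_real.
Unshelve. all: by end_near. Qed.

(** A product of two integrable functions may fail to be integrable, but a primitive is bounded and
    measurable on [0, T]. *)
Lemma integrable_mul_prim f g T : 0 <= T ->
  mu.-integrable `[0, T] (EFin \o f) -> mu.-integrable `[0, T] (EFin \o g) ->
  mu.-integrable `[0, T] (EFin \o (fun t => f t * prim g t)).
Proof.
move=> T0 fi gi.
have := integrableMl _ fi (measurable_prim T0 gi) (bounded_prim gi).
by apply.
Qed.

(* Both sides integrate f(s) g(r) over the triangle 0 <= r <= s <= T. *)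
Lemma Rintegral_mul_prim f g T : 0 <= T ->
  mu.-integrable `[0, T] (EFin \o f) -> mu.-integrable `[0, T] (EFin \o g) ->
  \int[mu]_(s in `[0, T]) (f s * prim g s) =
  \int[mu]_(r in `[0, T]) (g r * (prim f T - prim f r)).
Proof.
move=> T0 fi gi.
pose D := ([set` `[0, T]] : set R).
have mD : @measurable _ (measurableTypeR R) D by exact: measurable_itv.
(* Extension by zero moves everything to the whole plane, where [h] below cuts out the triangle and
   Fubini applies. *)
pose fh : R -> R := f \_ D; pose gh : R -> R := g \_ D.
have fhi : mu.-integrable setT (EFin \o fh).
  by move: fi => /(integrable_mkcond _ mD); rewrite restrict_EFin.
have ghi : mu.-integrable setT (EFin \o gh).
  by move: gi => /(integrable_mkcond _ mD); rewrite restrict_EFin.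
have mf : measurable_fun setT fh by apply/measurable_EFinP; exact: measurable_int fhi.
have mg : measurable_fun setT gh by apply/measurable_EFinP; exact: measurable_int ghi.
pose h (z : R * R) := if z.2 <= z.1 then fh z.1 * gh z.2 else 0.
have mh : measurable_fun setT (EFin \o h).
  apply/measurable_EFinP; apply: measurable_fun_ifT => //.
  - exact: measurable_fun_ler.
  - by apply: measurable_funM; exact: measurableT_comp.
(* The iterated integral of the absolute value factors into the two L1 norms; this product then
   dominates [h]. *)
have ifg : (mu \x mu)%E.-integrable setT (EFin \o (fun z => fh z.1 * gh z.2)).
  apply/integrable12ltyP => /=.
    by apply/measurable_EFinP; apply: measurable_funM; exact: measurableT_comp.
  under eq_integral => x _.
    under eq_integral => y _ do rewrite normrM EFinM.
    rewrite ge0_integralZl//; last first.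
      by apply/measurable_EFinP; exact: measurableT_comp.
    over.
  rewrite /= ge0_integralZr//; last 2 first.
  - by apply/measurable_EFinP; exact: measurableT_comp.
  - exact: integral_ge0.
  have /integrableP[_ /= ioof] := fhi.
  have /integrableP[_ /= ioog] := ghi.
  by rewrite lte_mul_pinfty// ?integral_ge0// ge0_fin_numE// integral_ge0.
have ih : (mu \x mu)%E.-integrable setT (EFin \o h).
  apply: le_integrable ifg => // z _ /=; rewrite lee_fin /h.
  by case: ifP => //; rewrite normr0.
have := Fubini ih.
rewrite /Rintegral.
(* For a fixed first variable [s] the second runs over [0, s], which produces [prim g s]. *)
have -> : (\int[mu]_x \int[mu]_y (EFin \o h) (x, y) =
  \int[mu]_(s in `[0%R, T]) (f s * prim g s)%:E)%E.
  rewrite [RHS]integral_mkcond; apply: eq_integral => s _.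
  rewrite patchE; case: ifPn => sD.
    have /andP[s0 sT] : 0 <= s <= T by move: sD; rewrite inE/= in_itv.
    have gsi := integrable_itv_le sT gi.
    rewrite EFinM fineK; last exact: integrable_fin_num.
    rewrite -integralZl// [RHS]integral_mkcond; apply: eq_integral => y _.
    rewrite /h /= patchE /fh patchE sD /gh patchE !mem_setE !in_itv/=.
    case: (leP y s) => ys; last by rewrite andbF.
    by rewrite (le_trans ys sT) andbT; case: (0 <= y) => //; rewrite mulr0.
  apply: integral0_eq => y _ /=; rewrite /h /= /fh patchE (negbTE sD) mul0r.
  by case: ifP.
move=> ->; congr fine.
rewrite [RHS]integral_mkcond; apply: eq_integral => s _.
rewrite patchE; case: ifPn => sD; last first.
  apply: integral0_eq => y _ /=; rewrite /h /= /gh patchE (negbTE sD) mulr0.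
  by case: ifP.
have /andP[s0 sT] : 0 <= s <= T by move: sD; rewrite inE/= in_itv.
(* Here [s] is the second variable of [h], and the first runs over [s, T]. The difference of
   primitives is an integral over the half-open interval, and its missing endpoint is null. *)
rewrite Rintegral_itvB// Rintegral_itv_obnd_cbnd; last first.
  by apply: integrableS fi => //; apply: subset_itvr; rewrite bnd_simp.
have fsi : mu.-integrable `[s, T] (EFin \o f).
  by apply: integrableS fi => //; apply: subset_itvr; rewrite bnd_simp.
rewrite EFinM fineK; last exact: integrable_fin_num.
rewrite -integralZl// [RHS]integral_mkcond; apply: eq_integral => y _.
rewrite /h /= patchE /gh patchE sD /fh patchE !mem_setE !in_itv/=.
case: (leP s y) => ys /=; last by [].
by rewrite (le_trans s0 ys)/= mulrC; case: (y <= T) => //; rewrite mulr0.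
Qed.

(** Integration by parts without differentiating: the exchange of integrals turns the first summand
    into [prim f T * prim g T] minus the second. *)
Lemma prim_mul f g T : 0 <= T ->
  mu.-integrable `[0, T] (EFin \o f) -> mu.-integrable `[0, T] (EFin \o g) ->
  prim f T * prim g T =
  \int[mu]_(s in `[0, T]) (f s * prim g s + prim f s * g s).
Proof.
move=> T0 fi gi.
have fgi := integrable_mul_prim T0 fi gi.
have gfi := integrable_mul_prim T0 gi fi.
rewrite RintegralD//; last first.
  by apply: eq_integrable gfi => // x _ /=; rewrite mulrC.
rewrite Rintegral_mul_prim//.
have -> : \int[mu]_(r in `[0, T]) (g r * (prim f T - prim f r)) =
    \int[mu]_(r in `[0, T]) (g r * prim f T) -
    \int[mu]_(r in `[0, T]) (g r * prim f r).
  rewrite -RintegralB//; last exact: (@integrableZr _ _ _ mu _ _ (prim f T) (EFin \o g)).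
  by apply: eq_Rintegral => r _; rewrite mulrBr.
rewrite RintegralZr// mulrC -[LHS]addr0 -addrA; congr (_ + _).
have -> : \int[mu]_(r in `[0, T]) (prim f r * g r) =
    \int[mu]_(r in `[0, T]) (g r * prim f r).
  by apply: eq_Rintegral => r _; rewrite mulrC.
by rewrite addrC subrr.
Qed.

Lemma integrable_prim f T : 0 <= T -> mu.-integrable `[0, T] (EFin \o f) ->
  mu.-integrable `[0, T] (EFin \o (fun t => prim f t)).
Proof.
move=> T0 fi; apply: measurable_bounded_integrable => //.
- exact: itv_lty.
- exact: measurable_prim.
- exact: bounded_prim.
Qed.

End Primitives.

(** * Integrability and integrals of finite linear combinations *)

Section Integrable.
Context d (X : measurableType d) (R : realType).
Variables (mu : {measure set X -> \bar R}) (D : set X) (mD : measurable D).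
Implicit Types f g : X -> R.

Lemma integrable_addr f g : mu.-integrable D (EFin \o f) ->
  mu.-integrable D (EFin \o g) -> mu.-integrable D (EFin \o (fun x => f x + g x)).
Proof. by move=> fi gi; exact: (integrableD mD fi gi). Qed.

Lemma integrable_mulr (c : R) f : mu.-integrable D (EFin \o f) ->
  mu.-integrable D (EFin \o (fun x => c * f x)).
Proof. by move=> fi; exact: (integrableZl mD c fi). Qed.

Lemma integrable_sumr (I : Type) (r : seq I) (P : pred I) (h : I -> X -> R) :
  (forall i, P i -> mu.-integrable D (EFin \o h i)) ->
  mu.-integrable D (EFin \o (fun x => \sum_(i <- r | P i) h i x)).
Proof.
move=> hi; have := integrable_sum mD r hi; apply: eq_integrable => // x _ /=.
by rewrite sumEFin.
Qed.

Lemma Rintegral_sum (I : Type) (r : seq I) (h : I -> X -> R) :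
  (forall i, mu.-integrable D (EFin \o h i)) ->
  \int[mu]_(x in D) (\sum_(i <- r) h i x) = \sum_(i <- r) \int[mu]_(x in D) h i x.
Proof.
move=> hi; elim: r => [|i r IH].
  rewrite big_nil; under eq_Rintegral do rewrite big_nil.
  by rewrite Rintegral_cst// mul0r.
under eq_Rintegral do rewrite big_cons.
by rewrite RintegralD// ?big_cons ?IH//; exact: integrable_sumr.
Qed.

End Integrable.

(** Integrating the weight exp(L s) gains a factor 1/L; this is what makes the Picard map a
    contraction on intervals of any length. *)
Lemma Rintegral_expR_le (R : realType) (L t : R) : 0 < L -> 0 <= t ->
  (@lebesgue_measure R).-integrable `[0, t] (EFin \o (fun s => expR (L * s))) /\
  \int[@lebesgue_measure R]_(s in `[0, t]) expR (L * s) <= expR (L * t) / L.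
Proof.
move=> L0 t0.
have cE : continuous (fun s : R => expR (L * s)).
  move=> s; apply: (@continuous_comp _ _ _ ( *%R L) expR); last exact: continuous_expR.
  exact: mulrl_continuous.
have dE (x : R) : is_derive x 1 (fun s : R => expR (L * s) / L) (expR (L * x)).
  apply: is_derive_eq; rewrite -[RHS]mul1r /GRing.scale/=; field.
  by rewrite gt_eqF.
split.
  apply: measurable_bounded_integrable => //.
  - exact: itv_lty.
  - by apply: measurable_funTS; exact: continuous_measurable_fun.
  - rewrite /bounded_near; near=> M => s /=.
    rewrite in_itv/= => /andP[s0 st]; rewrite ger0_norm ?expR_ge0//.
    apply: (@le_trans _ _ (expR (L * t))); first by rewrite ler_expR ler_pM2l.
    by near: M; apply: nbhs_pinfty_ge; rewrite num_real.
(* The fundamental theorem of calculus is applied on a nondegenerate interval, so t = 0 is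
   separate. *)
move: t0; rewrite le_eqVlt => /predU1P[<-|t0].
  by rewrite set_itv1 Rintegral_set1 divr_ge0// ?expR_ge0// ltW.
rewrite /Rintegral (@continuous_FTC2 _ _ (fun s : R => expR (L * s) / L)) //.
- by rewrite -EFinB/= lerBlDr lerDl divr_ge0// ?expR_ge0// ltW.
- exact: continuous_subspaceT.
- have cE' : continuous (fun s : R => expR (L * s) / L).
    by move=> s; apply: cvgMl; exact: cE.
  split.
  + by move=> x _; have := dE x; case.
  + by apply: cvg_at_right_filter; exact: cE'.
  + by apply: cvg_at_left_filter; exact: cE'.
- by move=> x _; rewrite derive1E; have := dE x; case.
Unshelve. all: by end_near. Qed.

(** * Picard iteration for a linear equation with locally integrable forcing *)

Section Picard.
Variables (R : realType) (k : nat) (A : 'M[R]_k) (b : 'I_k -> R -> R).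
Local Notation mu := (@lebesgue_measure R).
Hypothesis bi : forall t, 0 <= t -> forall i, mu.-integrable `[0, t] (EFin \o b i).

Fixpoint picard (J : nat) (i : 'I_k) (t : R) : R :=
  if J is J'.+1 then
    \int[mu]_(s in `[0, t]) (\sum_j A i j * picard J' j s + b i s)
  else 0.

Local Notation rhs J i := (fun s => \sum_j A i j * picard J j s + b i s).

Lemma integrable_rhs J t i : 0 <= t ->
  mu.-integrable `[0, t] (EFin \o rhs J i).
Proof.
move=> t0; elim: J i => [|J IH] i; apply: integrable_addr => //;
  [|exact: bi| |exact: bi]; apply: integrable_sumr => // j _; apply: integrable_mulr => //.
  exact: integrable0.
exact: integrable_prim.
Qed.

(* A rate at least twice the norm of A makes each Picard step halve the error
   measured relative to exp(L t). *)
Let L := 1 + 2 * \sum_i \sum_j `|A i j|.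

Let sA_ge0 : 0 <= \sum_i \sum_j `|A i j|.
Proof. by apply: sumr_ge0 => i _; apply: sumr_ge0. Qed.

Let L_gt0 : 0 < L.
Proof. by rewrite /L; move: sA_ge0; lra. Qed.

(** Induction on [J]: each increment integrates [A] times the previous one. The constant bounds the
    first iterate and depends only on the horizon [T], so the induction hypothesis can be used at
    all earlier times. *)
Lemma picard_step J t T i : 0 <= t <= T ->
  `|picard J.+1 i t - picard J i t| <=
  (\sum_l \int[mu]_(s in `[0, T]) `|b l s|) * expR (L * t) * 2^-1 ^+ J.
Proof.
move=> /andP[t0 tT]; set C := \sum_l _.
have C_ge0 : 0 <= C.
  by apply: sumr_ge0 => l _; apply: Rintegral_ge0 => s _.
have T0 := le_trans t0 tT.
elim: J i t t0 tT => [|J IH] i t t0 tT.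
  rewrite subr0 expr0 mulr1 /=.
  have -> : \int[mu]_(s in `[0, t]) (\sum_j A i j * 0 + b i s) =
      \int[mu]_(s in `[0, t]) b i s.
    by apply: eq_Rintegral => s _; rewrite big1 ?add0r// => j _; rewrite mulr0.
  apply: le_trans (prim_le_norm tT (bi T0 i)) _.
  apply: (@le_trans _ _ C).
    rewrite /C (bigD1 i)//= lerDl; apply: sumr_ge0 => l _.
    by apply: Rintegral_ge0.
  by rewrite ler_peMr// -expR0 ler_expR mulr_ge0// ltW.
have [Ei Ele] := Rintegral_expR_le L_gt0 t0.
rewrite [X in `|X - _|]/= [X in `|_ - X|]/= -RintegralB//; last 2 first.
- exact: integrable_rhs J.+1 t i t0.
- exact: integrable_rhs.
have di : mu.-integrable `[0, t] (EFin \o (fun s => rhs J.+1 i s - rhs J i s)).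
  by apply: (integrableB _ (integrable_rhs J.+1 i t0) (integrable_rhs J i t0)).
apply: le_trans (le_normr_Rintegral _ di) _ => //.
(* The sum over row [i] is enlarged to the sum over all entries, the quantity that [L] controls. *)
pose q := (\sum_i \sum_j `|A i j|) * C * 2^-1 ^+ J.
have q0 : 0 <= q by rewrite !mulr_ge0.
apply: (@le_trans _ _ (\int[mu]_(s in `[0, t]) (q * expR (L * s)))).
  apply: le_Rintegral => //.
  - exact: integrable_norm.
  - exact: integrable_mulr.
  move=> s; rewrite /= in_itv/= => /andP[s0 st].
  rewrite opprD addrACA subrr addr0 -sumrB.
  apply: le_trans (ler_norm_sum _ _ _) _.
  apply: (@le_trans _ _ ((\sum_j `|A i j|) * (C * expR (L * s) * 2^-1 ^+ J))).
    rewrite mulr_suml; apply: ler_sum => j _; rewrite -mulrBr normrM ler_wpM2l//.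
    exact: IH (le_trans st tT).
  rewrite /q -2!mulrA -mulrA [expR _ * _]mulrC ler_wpM2r//.
    by rewrite !mulr_ge0// expR_ge0.
  rewrite [leRHS](bigD1 i)//= lerDl; apply: sumr_ge0 => l _.
  exact: sumr_ge0.
rewrite RintegralZl//; apply: le_trans (ler_wpM2l q0 Ele) _.
rewrite mulrA ler_pdivrMr//.
have -> : C * expR (L * t) * 2^-1 ^+ J.+1 * L =
    (L / 2) * (C * 2^-1 ^+ J * expR (L * t)) by rewrite exprS; field.
have -> : q * expR (L * t) =
    (\sum_i \sum_j `|A i j|) * (C * 2^-1 ^+ J * expR (L * t)) by rewrite /q; ring.
rewrite ler_wpM2r//; first by rewrite !mulr_ge0// expR_ge0.
by rewrite /L; lra.
Qed.

(** The iterates are partial sums of their increments, which [picard_step] dominates by a geometric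
    series of ratio 1/2. *)
Lemma is_cvg_picard i t : 0 <= t -> cvgn (fun J => picard J i t).
Proof.
move=> t0; set u := fun J => _.
have -> : u = (fun J => u 0%N + series (telescope u) J).
  by apply/funext => J; rewrite [LHS]eq_sum_telescope.
apply: is_cvgD; first exact: is_cvg_cst.
apply: normed_cvg.
pose c := (\sum_l \int[mu]_(s in `[0, t]) `|b l s|) * expR (L * t).
have c0 : 0 <= c.
  by rewrite mulr_ge0 ?expR_ge0// sumr_ge0// => l _; exact: Rintegral_ge0.
apply: (@series_le_cvg _ _ (geometric c 2^-1)).
- by move=> J /=.
- by move=> J /=; rewrite mulr_ge0// exprn_ge0.
- by move=> J /=; apply: picard_step; rewrite t0 lexx.
- by apply: is_cvg_geometric_series; rewrite ger0_norm//; lra.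
Qed.

(** The bound is uniform in [J], as needed for dominated convergence in [linear_ode_exists]. *)
Lemma picard_bounded T : 0 <= T ->
  exists B, forall J t i, 0 <= t <= T -> `|picard J i t| <= B.
Proof.
move=> T0; pose C := \sum_l \int[mu]_(s in `[0, T]) `|b l s|.
have C0 : 0 <= C by apply: sumr_ge0 => l _; exact: Rintegral_ge0.
pose c := C * expR (L * T).
have c0 : 0 <= c by rewrite mulr_ge0 ?expR_ge0.
exists (2 * c) => J t i /andP[t0 tT].
(* The partial geometric sum is kept exactly so that the induction closes. *)
have : `|picard J i t| <= 2 * c * (1 - 2^-1 ^+ J).
  elim: J => [|J IH]; first by rewrite normr0 expr0 subrr mulr0.
  rewrite -[picard J.+1 i t](subrK (picard J i t)).
  apply: le_trans (ler_normD _ _) _.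
  have h : `|picard J.+1 i t - picard J i t| <= c * 2^-1 ^+ J.
    apply: le_trans (@picard_step J t T i _) _; first by rewrite t0.
    by rewrite ler_wpM2r ?exprn_ge0// ler_wpM2l// ler_expR ler_wpM2l// ltW.
  apply: le_trans (lerD h IH) _; rewrite exprS.
  by rewrite le_eqVlt; apply/orP; left; apply/eqP; field.
move=> /le_trans; apply; rewrite ler_piMr ?mulr_ge0// lerBlDr lerDl exprn_ge0//.
Qed.

(** The solution is the pointwise limit of the iterates. Their uniform bound together with |b|
    dominates the integrands, so the integral equation passes to the limit. *)
Lemma linear_ode_exists : exists x : 'I_k -> R -> R, forall t, 0 <= t -> forall i,
  mu.-integrable `[0, t] (EFin \o (fun s => \sum_j A i j * x j s + b i s)) /\
  x i t = \int[mu]_(s in `[0, t]) (\sum_j A i j * x j s + b i s).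
Proof.
pose x (i : 'I_k) (t : R) : R := limn (fun J => picard J i t).
have cx i t : 0 <= t -> picard J i t @[J --> \oo] --> x i t.
  by move=> t0; exact: is_cvg_picard.
exists x => t t0 i.
have crhs s : 0 <= s ->
    rhs J i s @[J --> \oo] --> \sum_j A i j * x j s + b i s.
  move=> s0; apply: cvgD; last exact: cvg_cst.
  apply: cvg_big; [exact: add_continuous|move=> j _].
  by apply: cvgMr; exact: cx.
have [B hB] := picard_bounded t0.
pose g s := (\sum_j `|A i j|) * B + `|b i s|.
have gi : mu.-integrable `[0, t] (EFin \o g).
  apply: integrable_addr => //; last exact: integrable_norm (bi t0 i).
  apply: measurable_bounded_integrable => //.
    exact: itv_lty.
  exact: bounded_cst.
have mr J : measurable_fun `[0, t] (EFin \o rhs J i).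
  exact: measurable_int (integrable_rhs J i t0).
have [] := @dominated_convergence _ _ R mu `[0, t] (measurable_itv _)
  (fun J => EFin \o rhs J i)
  (EFin \o (fun s => \sum_j A i j * x j s + b i s)) (EFin \o g) mr.
- apply: emeasurable_fun_cvg mr _ => s /=; rewrite in_itv/= => /andP[s0 _].
  by apply: cvg_EFin; [exact: nearW|exact: crhs].
- apply: aeW => s /=; rewrite in_itv/= => /andP[s0 _].
  by apply: cvg_EFin; [exact: nearW|exact: crhs].
- exact: gi.
- apply: aeW => s J /=; rewrite in_itv/= => sI.
  rewrite lee_fin /g; apply: le_trans (ler_normD _ _) _; rewrite lerD2r mulr_suml.
  apply: le_trans (ler_norm_sum _ _ _) _; apply: ler_sum => j _.
  by rewrite normrM ler_wpM2l// hB.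
move=> xi _ cint; split => //.
(* The shifted iterates converge to [x] and also to the integral of the limit integrand; uniqueness
   of limits identifies the two. *)
have h1 : picard J.+1 i t @[J --> \oo] --> x i t.
  by have := cx i t t0; rewrite -cvg_shiftS.
apply: (cvg_unique _ h1) => //.
have := cint.
rewrite -(fineK (integrable_fin_num _ xi))//.
by move/fine_cvg.
Qed.

End Picard.

(** * Square-integrable scalar functions and quadratic forms in them *)

Section SquareIntegrable.
Context d (X : measurableType d) (R : realType).
Variables (mu : {measure set X -> \bar R}) (D : set X) (mD : measurable D).
Implicit Types f g : X -> R.

(** Measurability is a separate clause because that of the square does not imply that of [f]. *)
Definition sqint f := measurable_fun D f /\
  mu.-integrable D (EFin \o (fun x => f x ^+ 2)).

(** Domination by f^2 + g^2. *)
Lemma sqint_mul f g : sqint f -> sqint g ->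
  mu.-integrable D (EFin \o (fun x => f x * g x)).
Proof.
move=> [mf fi] [mg gi]; apply: le_integrable (integrable_addr mD fi gi) => //.
  by apply/measurable_EFinP; exact: measurable_funM.
move=> x _ /=; rewrite lee_fin normrM [leRHS]ger0_norm ?addr_ge0 ?sqr_ge0//.
rewrite -(real_normK (num_real (f x))) -(real_normK (num_real (g x))).
have := normr_ge0 (f x); have := normr_ge0 (g x).
move: `|f x| `|g x| => a b b0 a0; nra.
Qed.

Lemma sqint_add f g : sqint f -> sqint g -> sqint (fun x => f x + g x).
Proof.
move=> hf hg; split; first by case: hf hg => ? _ [? _]; exact: measurable_funD.
have hfg := integrable_mulr mD 2 (sqint_mul hf hg).
apply: eq_integrable
  (integrable_addr mD (integrable_addr mD hf.2 hfg) hg.2) => // x _ /=.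
by congr EFin; ring.
Qed.

Lemma sqint_scale (c : R) f : sqint f -> sqint (fun x => c * f x).
Proof.
move=> [mf fi]; split; first exact: measurable_funM.
apply: eq_integrable (integrable_mulr mD (c ^+ 2) fi) => // x _ /=.
by rewrite exprMn.
Qed.

Lemma sqint_sum (I : Type) (r : seq I) (h : I -> X -> R) :
  (forall i, sqint (h i)) -> sqint (fun x => \sum_(i <- r) h i x).
Proof.
move=> hi; elim: r => [|i r IH].
  rewrite (_ : (fun _ => _) = cst 0); last by apply/funext => x; rewrite big_nil.
  split => //; apply: eq_integrable (integrable0 mu D) => // x _ /=.
  by rewrite expr0n.
rewrite (_ : (fun _ => _) = (fun x => h i x + \sum_(i <- r) h i x)).
  exact: sqint_add.
by apply/funext => x; rewrite big_cons.
Qed.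

Lemma sqint_cst (c : R) : (mu D < +oo)%E -> sqint (fun=> c).
Proof.
move=> Doo; split => //; apply: measurable_bounded_integrable => //.
exact: bounded_cst.
Qed.

Lemma sqint_bounded f : (mu D < +oo)%E -> measurable_fun D f ->
  [bounded f x | x in D] -> sqint f.
Proof.
move=> Doo mf fb; split => //.
have fi := measurable_bounded_integrable mD Doo mf fb.
by apply: eq_integrable (integrableMr mD mf fb fi).
Qed.

(** On a set of finite measure the constant 1 is square integrable and can serve as the second
    factor. *)
Lemma sqint_integrable f : (mu D < +oo)%E -> sqint f ->
  mu.-integrable D (EFin \o f).
Proof.
move=> Doo hf; apply: eq_integrable (sqint_mul hf (sqint_cst 1 Doo)) => // x _ /=.
by rewrite mulr1.
Qed.

Lemma sqint_mulmx m n (M : 'M[R]_(m, n)) (g : X -> 'cV[R]_n) :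
  (forall j, sqint (fun x => g x j 0)) -> forall i, sqint (fun x => (M *m g x) i 0).
Proof.
move=> hg i; rewrite (_ : (fun _ => _) = fun x => \sum_j M i j * g x j 0).
  by apply: sqint_sum => j; exact: sqint_scale.
by apply/funext => x; rewrite mxE.
Qed.

Lemma sqint_quad n (M : 'M[R]_n) (g : X -> 'cV[R]_n) :
  (forall j, sqint (fun x => g x j 0)) ->
  mu.-integrable D (EFin \o (fun x => ((g x)^T *m M *m g x) 0 0)).
Proof.
move=> hg; rewrite (_ : (fun _ => _) = fun x => \sum_j g x j 0 * (M *m g x) j 0).
  apply: integrable_sumr => // j _; apply: sqint_mul => //; exact: sqint_mulmx.
by apply/funext => x; rewrite -mulmxA mxE; apply: eq_bigr => j _; rewrite mxE.
Qed.

End SquareIntegrable.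

(** * The matrix inequality evaluated at one instant *)

Section Dissipation.
Variable R : realType.

(** The LMI is tested on the stacked vector [col_mx x v]; the blocks containing [P] regroup into the
    derivative of the storage x^T P x in the direction [f]. *)
Lemma lmi_pointwise n m k (M : 'M[R]_m)
    (A : 'M[R]_k) (B : 'M[R]_(k, n + n)) (C : 'M[R]_(m, k)) (D : 'M[R]_(m, n + n))
    (Pi : 'M[R]_2) (P : 'M[R]_k) (tau : R) (x : 'cV[R]_k) (v : 'cV[R]_(n + n)) :
  lmi M A B C D Pi P tau ->
  let f := A *m x + B *m v in
  let g := C *m x + D *m v in
  (f^T *m P *m x + x^T *m P *m f) 0 0 + tau * (g^T *m M *m g) 0 0 <=
  (v^T *m kronI n Pi *m v) 0 0.
Proof.
move=> Hlmi; cbv zeta; set f := A *m x + B *m v; set g := C *m x + D *m v.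
have := Hlmi (col_mx x v).
rewrite mulmxDr mulmxDl -scalemxAr -scalemxAl.
have -> : (col_mx x v)^T *m ((row_mx C D)^T *m M *m row_mx C D) *m col_mx x v
    = g^T *m M *m g.
  have -> : g = row_mx C D *m col_mx x v by rewrite mul_row_col.
  by rewrite trmx_mul !mulmxA.
rewrite tr_col_mx mul_row_block mul_row_col.
have -> : (x^T *m (A^T *m P + P *m A) + v^T *m (B^T *m P)) *m x +
    (x^T *m (P *m B) + v^T *m - kronI n Pi) *m v =
    (f^T *m P *m x + x^T *m P *m f) - v^T *m kronI n Pi *m v.
  rewrite /f [(_ + _)^T]raddfD/= !trmx_mul !mulmxDl !mulmxDr !mulmxDl !mulmxA mulmxN mulNmx.
  by rewrite -!addrA; congr (_ + _); rewrite addrCA.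
have entry (X Y Z : 'M[R]_1) : (X - Y + tau *: Z) 0 0 = X 0 0 - Y 0 0 + tau * Z 0 0.
  by rewrite !mxE.
by rewrite entry addrAC subr_le0.
Qed.

(** Every block of [kronI] is a scalar matrix, so the form sees [a] and [b] only through their inner
    products. *)
Lemma quad_kronI n (Pi : 'M[R]_2) (a b : 'cV[R]_n) :
  ((col_mx a b)^T *m kronI n Pi *m col_mx a b) 0 0 =
  Pi ord0 ord0 * dotv a a + (Pi ord0 ord_max + Pi ord_max ord0) * dotv a b +
  Pi ord_max ord_max * dotv b b.
Proof.
have tr_mul (c e : 'cV[R]_n) : (c^T *m e) 0 0 = dotv c e.
  by rewrite mxE; apply: eq_bigr => i _; rewrite mxE.
rewrite tr_col_mx mul_row_block mul_row_col !mulmxDl !mul_mx_scalar -!scalemxAl.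
have dC : dotv b a = dotv a b by apply: eq_bigr => i _; rewrite mulrC.
have entry p q r s (X Y Z W : 'M[R]_1) :
    (p *: X + q *: Y + (r *: Z + s *: W)) 0 0 =
    p * X 0 0 + q * Y 0 0 + (r * Z 0 0 + s * W 0 0) by rewrite !mxE.
by rewrite entry !tr_mul dC; ring.
Qed.

End Dissipation.

(** * State trajectories and the storage function *)

Section Energy.
Variables (R : realType) (k p : nat).
Local Notation mu := (@lebesgue_measure R).

Lemma state_sol_exists (A : 'M[R]_k) (B : 'M[R]_(k, p)) (v : sig R p) :
  (forall T, 0 <= T -> forall j, sqint mu `[0, T] (fun t => v t j 0)) ->
  exists x, state_sol A B v x.
Proof.
move=> hv; pose b (i : 'I_k) (t : R) : R := (B *m v t) i 0.
have bi t : 0 <= t -> forall i, mu.-integrable `[0, t] (EFin \o b i).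
  move=> t0 i; apply: sqint_integrable => //; first exact: itv_lty.
  by apply: sqint_mulmx => // j; exact: hv.
have [x hx] := linear_ode_exists A bi.
exists (fun t => \col_i x i t) => t t0 i; rewrite mxE.
have eF : (fun s => ((A *m (\col_i x i s) + B *m v s) i 0)) =
    (fun s => \sum_j A i j * x j s + b i s).
  apply/funext => s; rewrite mxE; congr (_ + _); rewrite mxE.
  by apply: eq_bigr => j _; rewrite mxE.
have [h1 h2] := hx t t0 i; split.
  by move: h1; rewrite -eF.
by rewrite h2 -eF.
Qed.

Variables (A : 'M[R]_k) (B : 'M[R]_(k, p)) (v : sig R p) (x : sig R k).
Hypothesis xsol : state_sol A B v x.
Let f s : 'cV[R]_k := A *m x s + B *m v s.

Let fi T (T0 : 0 <= T) i : mu.-integrable `[0, T] (EFin \o (fun s => f s i 0)).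
Proof. by have [] := xsol T0 i. Qed.

Let xE T (T0 : 0 <= T) i : x T i 0 = \int[mu]_(s in `[0, T]) f s i 0.
Proof. by have [] := xsol T0 i. Qed.

(** Each state component is a primitive, hence bounded and measurable on [0, T]. *)
Lemma sqint_state T : 0 <= T -> forall i, sqint mu `[0, T] (fun t => x t i 0).
Proof.
move=> T0 i.
have : sqint mu `[0, T] (fun t => \int[mu]_(s in `[0, t]) f s i 0).
  apply: sqint_bounded => //; first exact: itv_lty.
    by apply: measurable_prim => //; exact: fi.
  by apply: bounded_prim => //; exact: fi.
have eqx : {in [set` `[0, T]], (fun t => \int[mu]_(s in `[0, t]) f s i 0) =1
    (fun t => x t i 0)}.
  by move=> t; rewrite inE/= in_itv/= => /andP[t0 _]; rewrite -xE.
move=> [m1 i1]; split; first exact: eq_measurable_fun m1.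
by apply: eq_integrable i1 => // t tT /=; rewrite eqx.
Qed.

(** The storage expands into products of two primitives, and [prim_mul] applies to each. No boundary
    term at 0 appears because x(0) = 0. *)
Lemma storage_derivative (P : 'M[R]_k) T : 0 <= T ->
  let e s := ((f s)^T *m P *m x s + (x s)^T *m P *m f s) 0 0 in
  mu.-integrable `[0, T] (EFin \o e) /\
  ((x T)^T *m P *m x T) 0 0 = \int[mu]_(s in `[0, T]) e s.
Proof.
move=> T0 e.
(* The product-rule integrand for x_i x_j, with the states written as primitives to match
   [prim_mul]. *)
pose w i j s := f s i 0 * \int[mu]_(r in `[0, s]) f r j 0 +
   (\int[mu]_(r in `[0, s]) f r i 0) * f s j 0.
have wi i j : mu.-integrable `[0, T] (EFin \o w i j).
  apply: integrable_addr => //.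
    by apply: integrable_mul_prim => //; exact: fi.
  apply: eq_integrable (integrable_mul_prim T0 (fi T0 j) (fi T0 i)) => // s _ /=.
  by rewrite mulrC.
pose q i j s := P i j * w i j s.
have qi i j : mu.-integrable `[0, T] (EFin \o q i j) by exact: integrable_mulr.
have bil (a b : 'cV[R]_k) :
    (a^T *m P *m b) 0 0 = \sum_i \sum_j P i j * (a i 0 * b j 0).
  rewrite -mulmxA mxE; apply: eq_bigr => i _; rewrite !mxE big_distrr/=.
  by apply: eq_bigr => j _; ring.
have eq_e : {in [set` `[0, T]], (fun s => \sum_i \sum_j q i j s) =1 e}.
  move=> s; rewrite inE/= in_itv/= => /andP[s0 _].
  rewrite /e [RHS]mxE !bil -big_split/=; apply: eq_bigr => i _.
  rewrite -big_split/=; apply: eq_bigr => j _.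
  by rewrite -mulrDr /q /w !xE.
split.
  apply: eq_integrable (_ : mu.-integrable _ (EFin \o (fun s => \sum_i \sum_j q i j s))) => //.
    by move=> s sT /=; rewrite eq_e.
  by do 2 (apply: integrable_sumr => // ? _).
transitivity (\int[mu]_(s in `[0, T]) \sum_i \sum_j q i j s); last first.
  exact: eq_Rintegral.
rewrite bil Rintegral_sum//; last by move=> i; exact: integrable_sumr.
apply: eq_bigr => i _; rewrite Rintegral_sum//; apply: eq_bigr => j _.
by rewrite RintegralZl// -prim_mul ?xE//; exact: fi.
Qed.

End Energy.

Lemma SPi_Complex (R : realType) (Pi : 'M[R]_2) (X Y : R) : Pi^T = Pi ->
  0 <= Pi ord0 ord0 + (Pi ord0 ord_max + Pi ord_max ord0) * X +
       Pi ord_max ord_max * (X ^+ 2 + Y ^+ 2) ->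
  SPi Pi (Complex X Y).
Proof.
move=> symP h; rewrite /SPi /=.
have sym : Pi ord_max ord0 = Pi ord0 ord_max by rewrite -[in LHS]symP mxE.
have l0 : lift ord0 ord0 = ord_max :> 'I_2 by apply/val_inj.
have conjE : Num.conj (Complex X Y) = Complex X (- Y) by [].
rewrite !mxE !big_ord_recl big_ord0 !mxE !big_ord_recl !big_ord0 !mxE /= !l0 /=.
rewrite rmorph1 conjE sym.
have e : (1 * Complex (Pi ord0 ord0) 0 + (Complex X (- Y) * Complex (Pi ord0 ord_max) 0 + 0)) * 1 +
 ((1 * Complex (Pi ord0 ord_max) 0 + (Complex X (- Y) * Complex (Pi ord_max ord_max) 0 + 0)) * Complex X Y + 0)
 = Complex (Pi ord0 ord0 + (Pi ord0 ord_max + Pi ord_max ord0) * X +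
       Pi ord_max ord_max * (X ^+ 2 + Y ^+ 2)) 0.
  apply/eqP; rewrite sym eq_complex /=; apply/andP; split; apply/eqP; ring.
by rewrite e lecE /= eqxx.
Qed.

(** * Truncated signals, their inner products and Cauchy-Schwarz *)

Section Truncation.
Variable R : realType.
Local Notation mu := (@lebesgue_measure R).

(** On [0, T] the truncation agrees with the signal, and the square of one component is at most
    [dotv (u t) (u t)]. *)
Lemma inL2e_sqint n (u : sig R n) : inL2e u -> forall T, 0 <= T ->
  forall i, sqint mu `[0, T] (fun t => u t i 0).
Proof.
move=> hu T T0 i; have [mu_ uoo] := hu T T0.
have sub : [set` `[0, T]] `<=` ([set` `[0%R, +oo[] : set R).
  by move=> t; rewrite /= !in_itv/= andbT => /andP[].
have eqt : {in [set` `[0, T]], trunc T u =1 u}.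
  by move=> t; rewrite inE/= in_itv/= /trunc => ->.
have mi j : measurable_fun `[0, T] (fun t => u t j 0).
  apply: eq_measurable_fun (measurable_funS _ sub (mu_ j)) => // t tT /=.
  by rewrite eqt.
split; first exact: mi.
have di : mu.-integrable `[0%R, +oo[ (EFin \o (fun t => dotv (trunc T u t) (trunc T u t))).
  apply/integrableP; split.
    apply/measurable_EFinP; apply: measurable_sum => j.
    exact: (measurable_funM (mu_ j) (mu_ j)).
  apply: (le_lt_trans _ uoo); rewrite le_eqVlt; apply/orP; left; apply/eqP.
  apply: eq_integral => t _ /=; rewrite ger0_norm//.
  by apply: sumr_ge0 => j _; rewrite -expr2 sqr_ge0.
have dT : mu.-integrable `[0, T] (EFin \o (fun t => dotv (trunc T u t) (trunc T u t))).
  by move: di; apply: integrableS.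
move: dT; apply: le_integrable => //.
  by apply/measurable_EFinP; exact: (measurable_funX 2 (mi i)).
move=> t tT /=; rewrite lee_fin eqt ?inE// ger0_norm ?sqr_ge0//.
apply: le_trans (ler_norm _); rewrite /dotv (bigD1 i)//= -expr2 lerDl.
by apply: sumr_ge0 => j _; rewrite -expr2 sqr_ge0.
Qed.

Lemma sqint_sub n (u y : sig R n) T :
  (forall i, sqint mu `[0, T] (fun t => u t i 0)) ->
  (forall i, sqint mu `[0, T] (fun t => y t i 0)) ->
  forall i, sqint mu `[0, T] (fun t => (u t - y t) i 0).
Proof.
move=> hu hy i; have := sqint_add _ (hu i) (sqint_scale _ (-1) (hy i)).
rewrite (_ : (fun _ => _ + _) = (fun t => (u t - y t) i 0)); first by apply.
by apply/funext => t; rewrite !mxE mulN1r.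
Qed.

Lemma ip_trunc n (u y : sig R n) T :
  ip (trunc T u) (trunc T y) = \int[mu]_(t in `[0, T]) dotv (u t) (y t).
Proof.
rewrite /ip /Rintegral; congr fine.
have -> : [set` `[0, T]] = ([set` `[0%R, +oo[] : set R) `&` [set` `[0, T]].
  by rewrite setIidr// => t; rewrite /= !in_itv/= andbT => /andP[].
rewrite integral_mkcondr; apply: eq_integral => t _.
rewrite patchE mem_setE in_itv /= /trunc; case: ifP => //= _.
by rewrite /dotv big1// => i _; rewrite mxE mul0r.
Qed.

Lemma integrable_dotv n (u y : sig R n) T :
  (forall i, sqint mu `[0, T] (fun t => u t i 0)) ->
  (forall i, sqint mu `[0, T] (fun t => y t i 0)) ->
  mu.-integrable `[0, T] (EFin \o (fun t => dotv (u t) (y t))).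
Proof. by move=> ui yi; apply: integrable_sumr => // i _; exact: sqint_mul. Qed.

(** Passage from pointwise forms to inner products, used for Cauchy-Schwarz and for the integrated
    LMI. *)
Lemma Rintegral_quad n (u y : sig R n) T (p q r : R) :
  (forall i, sqint mu `[0, T] (fun t => u t i 0)) ->
  (forall i, sqint mu `[0, T] (fun t => y t i 0)) ->
  \int[mu]_(t in `[0, T])
    (p * dotv (u t) (u t) + q * dotv (u t) (y t) + r * dotv (y t) (y t)) =
  p * ip (trunc T u) (trunc T u) + q * ip (trunc T u) (trunc T y) +
  r * ip (trunc T y) (trunc T y).
Proof.
move=> ui yi; rewrite !ip_trunc.
have h1 := integrable_dotv ui ui; have h2 := integrable_dotv ui yi.
have h3 := integrable_dotv yi yi.
have k1 := integrable_mulr _ p h1; have k2 := integrable_mulr _ q h2.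
have k3 := integrable_mulr _ r h3.
rewrite RintegralD//; [|by apply: integrable_addr; [|exact: k1|exact: k2]|exact: k3].
by rewrite RintegralD//; [rewrite !RintegralZl|exact: k1|exact: k2].
Qed.

Lemma ip_ge0 n (u : sig R n) : 0 <= ip u u.
Proof.
apply: fine_ge0; apply: integral_ge0 => t _; rewrite lee_fin.
by apply: sumr_ge0 => i _; rewrite -expr2 sqr_ge0.
Qed.

Lemma ip_cauchy_schwarz n (u y : sig R n) T :
  (forall i, sqint mu `[0, T] (fun t => u t i 0)) ->
  (forall i, sqint mu `[0, T] (fun t => y t i 0)) ->
  ip (trunc T u) (trunc T y) ^+ 2 <=
  ip (trunc T u) (trunc T u) * ip (trunc T y) (trunc T y).
Proof.
move=> ui yi.
(* This is the squared norm of s u + r y on [0, T]. *)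
have pos s r : 0 <= s ^+ 2 * ip (trunc T u) (trunc T u) +
    2 * s * r * ip (trunc T u) (trunc T y) + r ^+ 2 * ip (trunc T y) (trunc T y).
  rewrite -Rintegral_quad//; apply: Rintegral_ge0 => t _.
  rewrite /dotv !big_distrr/= -!big_split/=; apply: sumr_ge0 => i _.
  by have := sqr_ge0 (s * u t i 0 + r * y t i 0); lra.
move: pos (ip_ge0 (trunc T u)) (ip_ge0 (trunc T y)).
move: (ip _ _) (ip _ _) (ip _ _) => c b a pos a0 c0.
have [a_gt0|] := ltP 0 a.
  (* With s = -b and r = a the form equals a (a c - b^2). *)
  by rewrite -subr_ge0 -(pmulr_rge0 _ a_gt0); have := pos (- b) a; lra.
move=> ale0; have {ale0 a0} a0 : a = 0 by lra.
(* With a = 0 this choice gives -(c + 2) b^2 >= 0, which forces b = 0. *)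
have := pos (- (c + 1)) b; rewrite a0 mul0r.
have b2 := sqr_ge0 b; have := mulr_ge0 c0 b2; lra.
Qed.

End Truncation.

(** Cauchy-Schwarz places the argument of [acos] in [-1, 1], so the cosine undoes it and the polar
    data become inner products. *)
Lemma gain_phaseE (R : realType) (n : nat) (u y : sig R n) (T : R) :
  (forall i, sqint (@lebesgue_measure R) `[0, T] (fun t => u t i 0)) ->
  (forall i, sqint (@lebesgue_measure R) `[0, T] (fun t => y t i 0)) ->
  let du := trunc T u in let dy := trunc T y in nrm du != 0 ->
  gain du dy * cos (phase du dy) = ip du dy / ip du du /\
  gain du dy ^+ 2 = ip dy dy / ip du du.
Proof.
move=> ui yi du dy nu0.
have CS := ip_cauchy_schwarz ui yi; rewrite -/du -/dy in CS.
have nu : nrm du ^+ 2 = ip du du by rewrite sqr_sqrtr// ip_ge0.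
have ny : nrm dy ^+ 2 = ip dy dy by rewrite sqr_sqrtr// ip_ge0.
rewrite /gain nu0; split; last by rewrite expr_div_n nu ny.
rewrite /phase nu0 /=; case: eqVneq => [y0|ny0] /=.
  (* A zero output has gain 0, so the left side vanishes; Cauchy-Schwarz makes the inner product
     vanish too. *)
  rewrite y0 !mul0r; move: CS; rewrite -ny y0 expr0n mulr0 => CS.
  have /eqP : ip du dy ^+ 2 = 0 by apply/le_anti; rewrite CS sqr_ge0.
  by rewrite sqrf_eq0 => /eqP ->; rewrite mul0r.
have nu_gt0 : 0 < nrm du by rewrite lt_neqAle eq_sym nu0 sqrtr_ge0.
have ny_gt0 : 0 < nrm dy by rewrite lt_neqAle eq_sym ny0 sqrtr_ge0.
rewrite acosK.
  by rewrite -nu; field; rewrite nu0 ny0.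
rewrite in_itv/= -ler_norml normrM normfV (gtr0_norm (mulr_gt0 _ _))//.
rewrite ler_pdivrMr ?mulr_gt0// mul1r.
rewrite -(@ler_pXn2r _ 2)// ?nnegrE ?mulr_ge0 ?sqrtr_ge0//.
by rewrite exprMn nu ny real_normK ?num_real.
Qed.

Lemma ip_form_ge0 (R : realType) (n m k : nat) (H : sig R n -> sig R n)
    (M : 'M[R]_m) (AN : 'M[R]_k) (BN : 'M[R]_(k, n + n)) (CN : 'M[R]_(m, k))
    (DN : 'M[R]_(m, n + n)) (Pi : 'M[R]_2) (P : 'M[R]_k) (tau : R) (u1 u2 : sig R n) T :
  is_system H -> hard_iqc H M AN BN CN DN -> psd P -> 0 < tau ->
  lmi M AN BN CN DN Pi P tau -> inL2e u1 -> inL2e u2 -> 0 < T ->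
  let du := trunc T (ssub u1 u2) in let dy := trunc T (ssub (H u1) (H u2)) in
  0 <= Pi ord0 ord0 * ip du du + (Pi ord0 ord_max + Pi ord_max ord0) * ip du dy +
       Pi ord_max ord_max * ip dy dy.
Proof.
move=> [sysH _] iqc psdP tau0 Hlmi hu1 hu2 T_gt0 /=.
set du := trunc T (ssub u1 u2); set dy := trunc T (ssub (H u1) (H u2)).
have T0 := ltW T_gt0.
have hdu t : 0 <= t -> forall i, sqint (@lebesgue_measure R) `[0, t] (fun s => ssub u1 u2 s i 0).
  by move=> t0 i; apply: sqint_sub => j; exact: inL2e_sqint.
have hdy t : 0 <= t -> forall i, sqint (@lebesgue_measure R) `[0, t] (fun s => ssub (H u1) (H u2) s i 0).
  by move=> t0 i; apply: sqint_sub => j; apply: inL2e_sqint => //; exact: sysH.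
pose v : sig R (n + n) := fun t => col_mx (u1 t - u2 t) (H u1 t - H u2 t).
have hv t : 0 <= t -> forall j, sqint (@lebesgue_measure R) `[0, t] (fun s => v s j 0).
  move=> t0 j; rewrite -(splitK j); case: (fintype.split j) => i /=.
    rewrite (_ : (fun _ => _) = (fun s => ssub u1 u2 s i 0)); first exact: hdu.
    by apply/funext => s; rewrite col_mxEu.
  rewrite (_ : (fun _ => _) = (fun s => ssub (H u1) (H u2) s i 0)); first exact: hdy.
  by apply/funext => s; rewrite col_mxEd.
(* The IQC speaks about a given trajectory of [N], so one has to be exhibited. *)
have [x xsol] := state_sol_exists AN BN hv.
pose e s := ((AN *m x s + BN *m v s)^T *m P *m x s +
  (x s)^T *m P *m (AN *m x s + BN *m v s)) 0 0.
have [ei eE] : (@lebesgue_measure R).-integrable `[0, T] (EFin \o e) /\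
    ((x T)^T *m P *m x T) 0 0 = \int[@lebesgue_measure R]_(s in `[0, T]) e s.
  exact: (storage_derivative xsol P T0).
have hg j : sqint (@lebesgue_measure R) `[0, T] (fun s => (CN *m x s + DN *m v s) j 0).
  rewrite (_ : (fun _ => _) = (fun s => (CN *m x s) j 0 + (DN *m v s) j 0)).
    apply: sqint_add => //; apply: sqint_mulmx => // l; last exact: hv.
    exact: (sqint_state xsol).
  by apply/funext => s; rewrite mxE.
pose gMg s := ((CN *m x s + DN *m v s)^T *m M *m (CN *m x s + DN *m v s)) 0 0.
have gi : (@lebesgue_measure R).-integrable `[0, T] (EFin \o gMg) by exact: sqint_quad.
have tgi : (@lebesgue_measure R).-integrable `[0, T] (EFin \o (fun s => tau * gMg s)).
  exact: integrable_mulr.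
have vi : (@lebesgue_measure R).-integrable `[0, T]
    (EFin \o (fun s => ((v s)^T *m kronI n Pi *m v s) 0 0)).
  by apply: sqint_quad => //; exact: hv.
have iqcT : 0 <= \int[@lebesgue_measure R]_(s in `[0, T]) gMg s.
  exact: (fine_ge0 (iqc u1 u2 hu1 hu2 x xsol T T_gt0)).
have eti : (@lebesgue_measure R).-integrable `[0, T] (EFin \o (fun s => e s + tau * gMg s)).
  exact: integrable_addr.
have : \int[@lebesgue_measure R]_(s in `[0, T]) (e s + tau * gMg s) <=
    \int[@lebesgue_measure R]_(s in `[0, T]) ((v s)^T *m kronI n Pi *m v s) 0 0.
  by apply: le_Rintegral => // s _; exact: lmi_pointwise.
rewrite RintegralD//.
rewrite -eE RintegralZl//.
rewrite (_ : \int[@lebesgue_measure R]_(s in `[0, T]) ((v s)^T *m kronI n Pi *m v s) 0 0 =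
  Pi ord0 ord0 * ip du du + (Pi ord0 ord_max + Pi ord_max ord0) * ip du dy +
       Pi ord_max ord_max * ip dy dy); last first.
  rewrite -Rintegral_quad; [|exact: hdu|exact: hdy].
  by apply: eq_Rintegral => s _; rewrite quad_kronI.
(* The form dominates the storage at time T plus [tau] times the IQC integral, both nonnegative. *)
apply: le_trans; apply: addr_ge0; first exact: psdP.
exact: mulr_ge0 (ltW tau0) iqcT.
Qed.

Theorem theorem2 (R : realType) (n m k : nat) (H : sig R n -> sig R n)
  (M : 'M[R]_m) (AN : 'M[R]_k) (BN : 'M[R]_(k, n + n)) (CN : 'M[R]_(m, k))
  (DN : 'M[R]_(m, n + n)) (Pi : 'M[R]_2) (P : 'M[R]_k) (tau : R) :
  is_system H -> causal H ->
  M^T = M -> hurwitz AN ->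
  hard_iqc H M AN BN CN DN ->
  Pi^T = Pi -> P^T = P -> psd P -> 0 < tau ->
  lmi M AN BN CN DN Pi P tau ->
  SRGe H `<=` SPi Pi.
Proof.
move=> sysH _ _ _ iqc symPi _ psdP tau0 Hlmi z [u1 [u2 [T [s [hu1 hu2 T0 du0 ->]]]]].
have form := ip_form_ge0 sysH iqc psdP tau0 Hlmi hu1 hu2 T0.
have hdu i : sqint (@lebesgue_measure R) `[0, T] (fun s => ssub u1 u2 s i 0).
  by apply: sqint_sub => j; apply: inL2e_sqint => //; exact: ltW.
have hdy i : sqint (@lebesgue_measure R) `[0, T] (fun s => ssub (H u1) (H u2) s i 0).
  by apply: sqint_sub => j; apply: inL2e_sqint; rewrite ?ltW//; apply: sysH.1.
have [reE gainE] := gain_phaseE hdu hdy du0.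
move: form reE gainE.
set du := trunc T (ssub u1 u2); set dy := trunc T (ssub (H u1) (H u2)) => form reE gainE.
apply: SPi_Complex => //.
(* Squaring removes the sign, so both conjugate points are handled at once and the squared modulus
   is the squared gain. *)
rewrite !exprMn sqrr_sign mul1r -mulrDr cos2Dsin2 mulr1 gainE reE.
have a0 : 0 < ip du du.
  by move: du0; rewrite sqrtr_eq0 -ltNge.
(* Multiplying by the positive [ip du du] clears the denominators and recovers [form]. *)
rewrite -(pmulr_rge0 _ a0); move: form; congr (_ <= _).
by field; rewrite gt_eqF.
Qed.
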